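(* Suppose that $\{\gamma_n\}_{n\ge0}$ is a monotone increasing sequence of real numbers with $\gamma_0=0$ such that for some constant $C>0$, $\gamma_{n+1}-\gamma_n=C$ for all $n\ge0$. Let $F\in X_\gamma$ have a finite number of zeros inside the unit disc $\mathbb{D}$, labeled $\alpha_1,\dots,\alpha_m$ (listed with multiplicity), with Blaschke decomposition $F=B\cdot G$. Then $$\|G(e^{i\cdot})\|_{X_\gamma}^2=\|F(e^{i\cdot})\|_{X_\gamma}^2-\sum_{j=1}^m\left((1-|\alpha_j|^2)\left\|\frac{G(e^{i\cdot})}{1-\overline{\alpha_j}e^{i\cdot}}\right\|_{Y_\gamma}^2\right).$$
   Context: $\mathbb{D}$ is the open unit disc and $\mathcal{H}^2=\mathcal{H}^2(\mathbb{D})$ is the Hardy space of analytic functions $F(z)=\sum_{n\ge0}a_nz^n$ on $\mathbb{D}$ with $\|F\|_{\mathcal{H}^2}^2=\sum_{n\ge0}|a_n|^2<\infty$. For $F(z)=\sum_{j\ge0}a_jz^j\in\mathcal{H}^2$ put $$\|F\|_{X_\gamma}^2=\sum_{j\ge0}\gamma_j|a_j|^2,\qquad \|F\|_{Y_\gamma}^2=\sum_{j\ge0}(\gamma_{j+1}-\gamma_j)|a_j|^2,$$ and $X_\gamma$ (resp. $Y_\gamma$) is the set of $F\in\mathcal{H}^2$ for which the first (resp. second) quantity is finite. A function $h(e^{i\cdot})$ on the circle is identified with the analytic function $h(z)$ on $\mathbb{D}$ of which it is the boundary function; norms are computed from the Taylor coefficients of $h$. Blaschke decomposition: if $F$ has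 zeros $\alpha_1,\dots,\alpha_m$ in $\mathbb{D}$ (repeated according to multiplicity), then $F=B\cdot G$ with $B(z)=\prod_{j=1}^m\frac{z-\alpha_j}{1-\overline{\alpha_j}z}$ and $G\in\mathcal{H}^2$ without zeros in $\mathbb{D}$ ($B$ and $G$ are determined up to a unimodular constant, which does not affect the norms). *)

(* Defs.v *)
From HB Require Import structures.
From mathcomp Require Import all_boot all_order all_algebra.
From mathcomp Require Import all_classical all_reals all_analysis.
From mathcomp Require Import complex.

Set Implicit Arguments.
Unset Strict Implicit.
Unset Printing Implicit Defensive.

Import Order.TTheory GRing.Theory Num.Theory numFieldNormedType.Exports.
Import Normc.
Local Open Scope ring_scope.
Local Open Scope classical_set_scope.

(* Functions on the unit disc are represented by total functions [R[i] -> R[i]]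
   of which only the values on [unit_disc] are used; [normc] is the modulus with
   values in [R]. *)

Definition unit_disc (R : realType) : set R[i] := [set z | `|z| < 1].

(* The ascription to [numFieldType] selects the usual topology of [R[i]]. *)
Definition power_series_of (R : realType) (F : R[i] -> R[i]) (a : nat -> R[i]) :
    Prop :=
  forall z, unit_disc z ->
    series (fun n => a n * z ^+ n) @ \oo --> (F z : (R[i] : numFieldType)).

Definition analytic_on_disc (R : realType) (F : R[i] -> R[i]) : Prop :=
  exists a, power_series_of F a.

(* The (unique) coefficient sequence of an analytic function; 0 by convention
   when [F] is not analytic on the disc. *)
Definition taylor (R : realType) (F : R[i] -> R[i]) : nat -> R[i] :=
  xget (fun=> 0) [set a | power_series_of F a].

Definition hardy2 (R : realType) (F : R[i] -> R[i]) : Prop :=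
  analytic_on_disc F /\
  (\sum_(0 <= n <oo) ((normc (taylor F n) ^+ 2)%:E : \bar R) < +oo)%E.

Definition sqnormX (R : realType) (gamma : nat -> R) (F : R[i] -> R[i]) :
    \bar R :=
  (\sum_(0 <= j <oo) (gamma j * normc (taylor F j) ^+ 2)%:E)%E.

Definition sqnormY (R : realType) (gamma : nat -> R) (F : R[i] -> R[i]) :
    \bar R :=
  (\sum_(0 <= j <oo) ((gamma j.+1 - gamma j) * normc (taylor F j) ^+ 2)%:E)%E.

Definition spaceX (R : realType) (gamma : nat -> R) : set (R[i] -> R[i]) :=
  [set F | hardy2 F /\ (sqnormX gamma F < +oo)%E].

(* [k = 0] means [F z != 0]. *)
Definition zero_order (R : realType) (F : R[i] -> R[i]) (z : R[i]) (k : nat) :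
    Prop :=
  exists H : R[i] -> R[i], [/\ analytic_on_disc H, H z != 0 &
    forall w, unit_disc w -> F w = (w - z) ^+ k * H w].

(* [s] lists all the zeros of [F] in the disc, with multiplicity. *)
Definition zeros_in_disc (R : realType) (F : R[i] -> R[i]) (s : seq R[i]) :
    Prop :=
  (forall a, a \in s -> unit_disc a) /\
  (forall z, unit_disc z -> zero_order F z (count_mem z s)).

Definition blaschke (R : realType) (s : seq R[i]) (z : R[i]) : R[i] :=
  \prod_(a <- s) ((z - a) / (1 - a^* * z)).

Definition blaschke_decomposition (R : realType) (F : R[i] -> R[i])
    (s : seq R[i]) (G : R[i] -> R[i]) : Prop :=
  [/\ hardy2 G, forall z, unit_disc z -> G z != 0 &
      forall z, unit_disc z -> F z = blaschke s z * G z].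

(* Main.v *)
(* Since [gamma n = C * n], the claim compares the Dirichlet integrals
   D(f) = sum n |f_n|^2 of F and G.  Let H be in the Hardy space, w in the disc
   and K = H / (1 - w^* z), so that f = (z - w) K is H times a Blaschke factor.
   On coefficients f_n = k_(n-1) - w k_n and h_n = k_n - w^* k_(n-1), hence
   |h_n|^2 - |f_n|^2 = (1 - |w|^2) (|k_n|^2 - |k_(n-1)|^2).
   Summing gives ||f|| = ||H||, and summing against the weights n gives
   D(f) = D(H) + (1 - |w|^2) ||K||^2; the boundary term N |k_N|^2 is small along
   a subsequence because sum |k_n|^2 converges.  Adding the Blaschke factors one
   at a time, the isometry lets K be computed from G alone. *)
Require Import Defs.
From mathcomp Require Import all_boot all_order all_algebra.
From mathcomp Require Import all_classical all_reals all_analysis.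
From mathcomp Require Import complex ring lra.

Set Implicit Arguments.
Unset Strict Implicit.
Unset Printing Implicit Defensive.

Import Order.TTheory GRing.Theory Num.Theory numFieldNormedType.Exports.
Import Normc.
Local Open Scope ring_scope.

(** * Series of nonnegative terms, and uniqueness of power series coefficients *)

(** Otherwise [k n] dominates a multiple of [harmonic n] from [N] on, against the divergence of the
    harmonic series. *)
Lemma summable_frequently_small (R : realType) (k : nat -> R) :
  (forall n, 0 <= k n) -> (\sum_(0 <= n <oo) (k n)%:E < +oo)%E ->
  forall (e : R) N, 0 < e -> exists2 n, (N <= n)%N & n.+1%:R * k n < e.
Proof.
move=> k0 kfin e N e0; apply: contrapT => no_small.
have large n : (N <= n)%N -> harmonic n <= e^-1 * k n.
  move=> Nn; rewrite ler_pdivlMl//= ler_pdivrMr ?ltr0n// mulrC leNgt.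
  by apply/negP => lt_e; apply: no_small; exists n.
(* The comparison test wants the bound at every index, hence the truncation below [N]. *)
pose u n : R := if (n < N)%N then 0 else harmonic n.
have cvgu : cvgn (series u).
  apply: (@series_le_cvg R u (fun n => e^-1 * k n)) => [n|n|n|].
  - by rewrite /u; case: ifP => // _; exact: harmonic_ge0.
  - by rewrite mulr_ge0// invr_ge0 ltW.
  - rewrite /u; case: ltnP => [_|/large//].
    by rewrite mulr_ge0// invr_ge0 ltW.
  - by apply: (@is_cvg_seriesZ _ k e^-1); exact: nnseries_is_cvg.
apply: (@dvg_harmonic R).
rewrite -(is_cvg_series_restrict N).
have <- : (fun n => \sum_(N <= i < n) u i) = (fun n => \sum_(N <= i < n) harmonic i).
  apply/funext => n; apply: eq_big_nat => i /andP[Ni _].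
  by rewrite /u ltnNge Ni.
by rewrite (is_cvg_series_restrict N).
Qed.

(* The defects [r] need not tend to 0: since partial sums of nonnegative terms
   are monotone, it is enough that they are small infinitely often. *)
Lemma eq_nneseries_frequently (R : realType) (p q r : nat -> R) :
  (forall n, 0 <= p n) -> (forall n, 0 <= q n) -> (forall n, 0 <= r n) ->
  (forall n, \sum_(0 <= i < n.+1) q i = \sum_(0 <= i < n.+1) p i + r n) ->
  (forall (e : R) N, 0 < e -> exists2 n, (N <= n)%N & r n < e) ->
  (\sum_(0 <= n <oo) (p n)%:E = \sum_(0 <= n <oo) (q n)%:E)%E.
Proof.
move=> p0 q0 r0 qpr small.
have partialD (u : nat -> R) m n : (forall i, 0 <= u i) -> (m <= n)%N ->
    \sum_(0 <= i < m) u i <= \sum_(0 <= i < n) u i.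
  move=> u0 mn; rewrite (@big_cat_nat _ _ _ m 0 n)//= lerDl.
  exact: sumr_ge0.
have cvge (u : nat -> R) : (forall i, 0 <= u i) ->
    cvgn (fun n => \sum_(0 <= i < n) (u i)%:E)%E.
  by move=> u0; apply: is_cvg_nneseries => n _ _; rewrite lee_fin.
apply/eqP; rewrite eq_le; apply/andP; split.
- apply: lime_le; first exact: cvge.
  apply: nearW => n; apply: (@le_trans _ _ (\sum_(0 <= i < n.+1) (q i)%:E)%E).
    rewrite !sumEFin lee_fin qpr -[leLHS]addr0 lerD//.
    exact: partialD.
  by apply: nneseries_lim_ge => i _ _; rewrite lee_fin.
- apply: lime_le; first exact: cvge.
  apply: nearW => n; apply/lee_addgt0Pr => e e0.
  have [N nN rN] := small e n e0.
  apply: (@le_trans _ _ (\sum_(0 <= i < N.+1) (p i)%:E + e%:E)%E).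
    rewrite !sumEFin -EFinD lee_fin.
    apply: (le_trans (partialD q n N.+1 q0 (leqW nN))).
    by rewrite qpr lerD2l ltW.
  rewrite leeD2r//.
  by apply: nneseries_lim_ge => i _ _; rewrite lee_fin.
Qed.

(* Abel summation of [h n - f n = c * (k n - k n.-1)]. *)
Lemma nneseries_eq_of_telescope (R : realType) (c : R) (f h k : nat -> R) :
  0 <= c -> (forall n, 0 <= f n) -> (forall n, 0 <= h n) ->
  (forall n, 0 <= k n) -> (\sum_(0 <= n <oo) (k n)%:E < +oo)%E ->
  h 0%N - f 0%N = c * k 0%N ->
  (forall n, h n.+1 - f n.+1 = c * (k n.+1 - k n)) ->
  (\sum_(0 <= n <oo) (f n)%:E = \sum_(0 <= n <oo) (h n)%:E)%E /\
  (\sum_(0 <= n <oo) (n%:R * f n)%:E =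
   \sum_(0 <= n <oo) (n%:R * h n)%:E + c%:E * \sum_(0 <= n <oo) (k n)%:E)%E.
Proof.
move=> c0 f0 h0 k0 kfin hf0 hfS.
have small (e : R) N : 0 < e ->
    exists2 n, (N <= n)%N & c * (n.+1%:R * k n) < e.
  (* [c] may be 0, so the tolerance is divided by [c + 1] instead. *)
  move=> e0; have c1 : 0 < c + 1 by rewrite ltr_wpDl.
  have [n Nn kn] := @summable_frequently_small R k k0 kfin (e / (c + 1)) N
    (divr_gt0 e0 c1).
  exists n => //; apply: (@le_lt_trans _ _ ((c + 1) * (n.+1%:R * k n))).
    by rewrite ler_wpM2r ?mulr_ge0// lerDl.
  by rewrite mulrC -ltr_pdivlMr.
split.
- apply: (@eq_nneseries_frequently R f h (fun n => c * k n)) => //.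
  + by move=> n; rewrite mulr_ge0.
  + elim=> [|n IH]; first by rewrite !big_nat1 -hf0 addrC subrK.
    rewrite big_nat_recr//= IH [in RHS]big_nat_recr//=.
    by have := hfS n; lra.
  + move=> e N /(small e N)[n Nn ltn]; exists n => //.
    apply: le_lt_trans ltn; rewrite ler_wpM2l// ler_peMl//.
    by rewrite ler1n.
- rewrite -nneseriesZl; last by move=> n _; rewrite lee_fin.
  rewrite -nneseriesD; last 2 first.
  + by move=> n _ _; rewrite lee_fin mulr_ge0.
  + by move=> n _ _; rewrite -EFinM lee_fin mulr_ge0.
  rewrite [RHS](eq_eseriesr (g := fun n => (n%:R * h n + c * k n)%:E)); last first.
    by move=> n _; rewrite EFinD EFinM.
  (* Summation by parts leaves this boundary term; the factor is [n.+1] rather than [n] because the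
     partial sum of [k] includes the index [n]. *)
  apply: (@eq_nneseries_frequently R _ _ (fun n => c * (n.+1%:R * k n))) => //.
  + by move=> n; rewrite mulr_ge0.
  + by move=> n; rewrite addr_ge0// mulr_ge0.
  + by move=> n; rewrite !mulr_ge0.
  + elim=> [|n IH]; first by rewrite !big_nat1 !mul0r !mul1r.
    rewrite big_nat_recr//= IH [in RHS]big_nat_recr//=.
    have -> : h n.+1 = f n.+1 + c * (k n.+1 - k n) by have := hfS n; lra.
    rewrite -[n.+2%:R]natr1; ring.
Qed.

(** [y] is dominated by the convolution of [x] with the geometric sequence [r ^+ n], which acts
    boundedly on l2. With [r] the modulus of [w], this controls division by [1 - w^* * z]. *)
Lemma l2_filter (R : realType) (r : R) (x y : nat -> R) :
  0 <= r < 1 -> (forall n, 0 <= x n) -> (forall n, 0 <= y n) ->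
  y 0%N <= x 0%N -> (forall n, y n.+1 <= x n.+1 + r * y n) ->
  (\sum_(0 <= n <oo) (x n ^+ 2)%:E < +oo)%E ->
  (\sum_(0 <= n <oo) (y n ^+ 2)%:E < +oo)%E.
Proof.
move=> /andP[r0 r1] x0 y0 yx0 yxS xfin.
have d0 : 0 < 1 - r by rewrite subr_gt0.
(* Convexity: [x + r y] is the mean of [x / (1 - r)] and [y] with weights
   [1 - r] and [r]. *)
have convex (a b t : R) : 0 <= t -> t <= a + r * b -> 0 <= b -> 0 <= a ->
    t ^+ 2 <= a ^+ 2 / (1 - r) + r * b ^+ 2.
  move=> t0 tab b0 a0; apply: (@le_trans _ _ ((a + r * b) ^+ 2)).
    by rewrite ler_sqr ?nnegrE// (le_trans t0).
  rewrite -subr_ge0.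
  have -> : a ^+ 2 / (1 - r) + r * b ^+ 2 - (a + r * b) ^+ 2 =
      r / (1 - r) * (a - (1 - r) * b) ^+ 2 by field; rewrite gt_eqF.
  by rewrite mulr_ge0 ?sqr_ge0// divr_ge0// ltW.
(* Summing [convex] puts [r] times the earlier squares of [y] on the right. Absorbing them leaves
   the factor [1 - r], and [r * y n ^+ 2] is left over from the index shift. *)
have partial n : (1 - r) * \sum_(0 <= i < n.+1) y i ^+ 2 + r * y n ^+ 2 <=
    (\sum_(0 <= i < n.+1) x i ^+ 2) / (1 - r).
  elim: n => [|n IH].
    rewrite !big_nat1 -mulrDl subrK mul1r.
    by have := convex (x 0%N) 0 _ (y0 0%N); rewrite mulr0 addr0 expr0n/= mulr0 addr0; exact.
  rewrite big_nat_recr//= [X in _ <= X / _]big_nat_recr//= [X in _ <= X]mulrDl.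
  have := convex _ _ _ (y0 n.+1) (yxS n) (y0 n) (x0 n.+1).
  move: IH; set u := \sum_(0 <= i < n.+1) y i ^+ 2; set v := _ / (1 - r).
  by set w := _ / (1 - r); lra.
have [X0 Xfin] : (0 <= \sum_(0 <= n <oo) (x n ^+ 2)%:E)%E /\
    (\sum_(0 <= n <oo) (x n ^+ 2)%:E)%E \is a fin_num.
  have X0 : (0 <= \sum_(0 <= n <oo) (x n ^+ 2)%:E)%E.
    by apply: nneseries_ge0 => n _ _; rewrite lee_fin sqr_ge0.
  by split=> //; rewrite ge0_fin_numE.
apply: (@le_lt_trans _ _ ((1 - r)^-1 ^+ 2 * fine (\sum_(0 <= n <oo) (x n ^+ 2)%:E)%E)%:E);
  last exact: ltry.
apply: lime_le; first by apply: is_cvg_nneseries => n _ _; rewrite lee_fin sqr_ge0.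
apply: nearW => n; apply: (@le_trans _ _ (\sum_(0 <= i < n.+1) (y i ^+ 2)%:E)%E).
  by rewrite !sumEFin lee_fin big_nat_recr//= lerDl sqr_ge0.
rewrite sumEFin lee_fin expr2 -mulrA ler_pdivlMl//.
apply: (@le_trans _ _ ((\sum_(0 <= i < n.+1) x i ^+ 2) / (1 - r))).
  by apply: le_trans (partial n); rewrite lerDl mulr_ge0 ?sqr_ge0.
rewrite mulrC ler_wpM2l ?invr_ge0 ?(ltW d0)//.
rewrite -lee_fin fineK// -sumEFin.
by apply: nneseries_lim_ge => i _ _; rewrite lee_fin sqr_ge0.
Qed.

(* Evaluating at [z = s / 2] for small [s], the tail of the series is at most
   [2 * M * s], where [M] bounds the terms of the series at [1 / 2]. *)
Lemma power_series_head_eq0 (K : numFieldType) (d : nat -> K) :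
  (forall z, z != 0 -> `|z| < 1 ->
    (series (fun n => d n * z ^+ n) @ \oo --> (0 : K))%classic) ->
  d 0%N = 0.
Proof.
move=> d_cvg0; apply/eqP; apply/negPn/negP => d0.
have half0 : (2^-1 : K) != 0 by rewrite invr_eq0 pnatr_eq0.
have half1 : `|2^-1 : K| < 1 by rewrite normfV normr_nat invf_lt1 ?ltr1n.
have /cvgP/cvg_series_cvg_0/cvgP/cvg_seq_bounded/ex_strict_bound_gt0 :=
  d_cvg0 _ half0 half1.
move=> [M M0 dM].
(* This makes [s <= 1/4] and the tail bound [2 * M * s] at most half the modulus of [d 0]. *)
pose s := `|d 0%N| / (4 * (M + `|d 0%N|)).
have nd0 : 0 < `|d 0%N| by rewrite normr_gt0.
have Md0 : 0 < M + `|d 0%N| by rewrite addr_gt0.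
have s0 : 0 < s by rewrite divr_gt0// mulr_gt0.
have s14 : s <= 4^-1.
  rewrite /s invfM mulrCA ler_piMr ?invr_ge0//.
  by rewrite ler_pdivrMr// mul1r lerDr ltW.
have s12 : s * 2 <= 1.
  apply: (@le_trans _ _ (4^-1 * 2)); first by rewrite ler_wpM2r.
  by rewrite ler_pdivrMl// mulr1 ler_nat.
have Ms : M * (2 * s) <= `|d 0%N| / 2.
  have -> : M * (2 * s) = `|d 0%N| / 2 * (M / (M + `|d 0%N|)).
    by rewrite /s; field; rewrite gt_eqF.
  rewrite ler_piMr ?divr_ge0// ler_pdivrMr// mul1r lerDl ltW//.
clearbody s.
(* The terms are at most [M * s ^+ i.+1], and their geometric sum is estimated using [s <= 1/2].
   Keeping the subtracted power of [s] lets the induction close. *)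
have tail N : `|\sum_(0 <= i < N) d i.+1 * (s / 2) ^+ i.+1| <=
    M * (2 * s - 2 * s ^+ N.+1).
  elim: N => [|N IH].
    by rewrite big_geq// normr0 expr1 subrr mulr0.
  rewrite big_nat_recr//=; apply: (le_trans (ler_normD _ _)).
  apply: (@le_trans _ _ (M * (2 * s - 2 * s ^+ N.+1) + M * s ^+ N.+1)).
    apply: lerD => //; rewrite exprMn mulrCA mulrC normrM.
    rewrite [`|s ^+ _|]ger0_norm ?exprn_ge0 ?(ltW s0)//.
    by rewrite ler_wpM2r ?exprn_ge0 ?(ltW s0)// ltW//; exact: dM.
  rewrite -mulrDr ler_wpM2l ?(ltW M0)// [s ^+ N.+2]exprS.
  have -> : 2 * s - 2 * s ^+ N.+1 + s ^+ N.+1 = 2 * s - s ^+ N.+1 by ring.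
  by rewrite lerD2l lerN2 mulrA [2 * s]mulrC ler_piMl ?exprn_ge0 ?(ltW s0).
have z0 : s / 2 != 0 by rewrite mulf_neq0// gt_eqF.
have z1 : `|s / 2| < 1.
  rewrite ger0_norm ?divr_ge0 ?(ltW s0)// ltr_pdivrMr// mul1r.
  apply: (@le_lt_trans _ _ 4^-1) => //.
  by rewrite (@lt_trans _ _ 1) ?invf_lt1 ?ltr1n.
have e0 : 0 < `|d 0%N| / 2 by rewrite divr_gt0.
have /cvgrPdist_lt/(_ _ e0)[N _ NS] := d_cvg0 _ z0 z1.
have := NS N.+1 (leqnSn N); rewrite /= sub0r normrN /series/= big_nat_recl//=.
rewrite expr0 mulr1; set t := \sum_(_ <= _ < _) _ => dt.
have : `|d 0%N| < `|d 0%N|.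
  rewrite -{1}[d 0%N](addrK t).
  apply: (le_lt_trans (ler_normB _ _)).
  rewrite [ltRHS](splitr `|d 0%N|); apply: ltr_leD => //.
  apply: le_trans (le_trans (tail N) _) Ms.
  rewrite ler_wpM2l ?(ltW M0)// lerBlDr lerDl mulr_ge0// exprn_ge0// ltW//.
by rewrite ltxx.
Qed.

(** Once the constant coefficient vanishes, dividing the series by [z] shifts the coefficients;
    hence the restriction to [z != 0]. *)
Lemma power_series_eq0 (K : numFieldType) (d : nat -> K) :
  (forall z, z != 0 -> `|z| < 1 ->
    (series (fun n => d n * z ^+ n) @ \oo --> (0 : K))%classic) ->
  forall n, d n = 0.
Proof.
move=> d_cvg0 n; elim: n d d_cvg0 => [|n IH] d d_cvg0.
  exact: power_series_head_eq0.
apply: (IH (fun n => d n.+1)) => z z0 z1.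
have -> : series (fun n => d n.+1 * z ^+ n) =
    (fun N => z^-1 * series (fun n => d n * z ^+ n) N.+1).
  apply/funext => N; rewrite /series/= big_nat_recl//=.
  rewrite power_series_head_eq0// mul0r add0r mulr_sumr.
  by apply: eq_bigr => i _; rewrite exprS mulrCA mulKf.
rewrite -(mulr0 z^-1); apply: cvgM; first exact: cvg_cst.
rewrite (cvg_shiftS (series (fun n => d n * z ^+ n))).
exact: d_cvg0.
Qed.

(** * Division and multiplication of power series by linear factors *)

Lemma cvgr0P (K : numFieldType) (u : nat -> K) :
  (u @ \oo --> (0 : K))%classic <->
  (forall e, 0 < e -> (\forall n \near \oo, `|u n| < e)%classic).
Proof.
split=> [/cvgrPdist_lt u0 e /u0|u0]; first by under eq_near do rewrite sub0r normrN.
apply/cvgrPdist_lt => e /u0.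
by under [X in _ -> X]eq_near do rewrite sub0r normrN.
Qed.

Lemma cvgr0_mul_expr (K : numFieldType) (u : nat -> K) (z : K) :
  (u @ \oo --> (0 : K))%classic -> `|z| < 1 ->
  (u n * z ^+ n.+1 @[n --> \oo] --> (0 : K))%classic.
Proof.
move=> /cvgr0P u0 z1; apply/cvgr0P => e /u0.
apply: filterS => n; apply: le_lt_trans.
by rewrite normrM ler_piMr// normrX exprn_ile1// ltW.
Qed.

(** The recursion telescopes: [1 - b * z] times a partial sum for [k] is the one for [h] minus
    [b * (k N * z ^+ N.+1)], which tends to 0. *)
Lemma cvg_series_div (K : numFieldType) (b z l : K) (h k : nat -> K) :
  1 - b * z != 0 ->
  k 0%N = h 0%N -> (forall n, k n.+1 = h n.+1 + b * k n) ->
  (k n * z ^+ n.+1 @[n --> \oo] --> (0 : K))%classic ->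
  (series (fun n => h n * z ^+ n) @ \oo --> l)%classic ->
  (series (fun n => k n * z ^+ n) @ \oo --> l / (1 - b * z))%classic.
Proof.
move=> bz kh0 khS kz0 hl.
rewrite -(cvg_shiftS (series (fun n => k n * z ^+ n))).
have -> : (fun N => series (fun n => k n * z ^+ n) N.+1) =
    (fun N => (series (fun n => h n * z ^+ n) N.+1 - b * (k N * z ^+ N.+1))
      / (1 - b * z)).
  apply/funext => N; apply: (canRL (mulfK bz)).
  elim: N => [|N IH]; first by rewrite /series/= !big_nat1 kh0 expr0 expr1; ring.
  rewrite /series/= in IH *.
  rewrite big_nat_recr//= mulrDl IH [in RHS]big_nat_recr//= khS !exprS.
  by ring.
apply: cvgM; last exact: cvg_cst.
rewrite -[l in (_ --> l)%classic]subr0; apply: cvgB.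
  by rewrite (cvg_shiftS (series (fun n => h n * z ^+ n))).
by rewrite -(mulr0 b); apply: cvgM => //; exact: cvg_cst.
Qed.

(** Here too the partial sums differ only by the boundary term [k N * z ^+ N.+1]. *)
Lemma cvg_series_mul (K : numFieldType) (w z l : K) (f k : nat -> K) :
  f 0%N = - w * k 0%N -> (forall n, f n.+1 = k n - w * k n.+1) ->
  (k n * z ^+ n.+1 @[n --> \oo] --> (0 : K))%classic ->
  (series (fun n => k n * z ^+ n) @ \oo --> l)%classic ->
  (series (fun n => f n * z ^+ n) @ \oo --> (z - w) * l)%classic.
Proof.
move=> fk0 fkS kz0 kl.
rewrite -(cvg_shiftS (series (fun n => f n * z ^+ n))).
have -> : (fun N => series (fun n => f n * z ^+ n) N.+1) =
    (fun N => (z - w) * series (fun n => k n * z ^+ n) N.+1 - k N * z ^+ N.+1).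
  apply/funext => N; elim: N => [|N IH].
    by rewrite /series/= !big_nat1 fk0 expr0 expr1; ring.
  rewrite /series/= in IH *.
  by rewrite big_nat_recr//= IH [in RHS]big_nat_recr//= fkS !exprS; ring.
rewrite -[(z - w) * l]subr0; apply: cvgB => //.
apply: cvgM; first exact: cvg_cst.
by rewrite (cvg_shiftS (series (fun n => k n * z ^+ n))).
Qed.

(** * Coefficient sequences of functions on the disc *)

Section power_series_of.
Variable R : realType.
Implicit Types (F H : R[i] -> R[i]) (a h k : nat -> R[i]) (z w : R[i]).

Lemma unit_discE z : unit_disc z = (normc z < 1) :> Prop.
Proof. by rewrite /unit_disc/= ltcR. Qed.

Lemma power_series_of_inj F a b :
  power_series_of F a -> power_series_of F b -> a = b.
Proof.
move=> Fa Fb; apply/funext => n; apply/eqP; rewrite -subr_eq0; apply/eqP.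
apply: (@power_series_eq0 R[i] (fun n => a n - b n)) => z _ z1.
have -> : series (fun n => (a n - b n) * z ^+ n) =
    series (fun n => a n * z ^+ n) - series (fun n => b n * z ^+ n).
  rewrite -seriesN -seriesD; congr series; apply/funext => i.
  exact: mulrBl.
rewrite -(subrr (F z)); apply: cvgB; [exact: Fa|exact: Fb].
Qed.

(** Uniqueness pins down the choice made by [xget], so the norms can be computed from any explicit
    expansion. *)
Lemma taylorE F a : power_series_of F a -> taylor F = a.
Proof.
move=> Fa; apply: (@power_series_of_inj F) => //.
by rewrite /taylor; case: xgetP => [b -> //|/(_ a)].
Qed.

Lemma eq_power_series_of F H a :
  (forall z, unit_disc z -> F z = H z) ->
  power_series_of F a -> power_series_of H a.
Proof. by move=> FH Fa z z1; rewrite -FH//; exact: Fa. Qed.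

Lemma normc_sqr (z : R[i]) : normc z ^+ 2 = complex.Re z ^+ 2 + complex.Im z ^+ 2.
Proof. by case: z => x y; rewrite sqr_sqrtr// addr_ge0 ?sqr_ge0. Qed.

Lemma normc_ge0 (z : R[i]) : 0 <= normc z.
Proof. by case: z => x y; exact: sqrtr_ge0. Qed.

Lemma normc_conj (z : R[i]) : normc z^* = normc z.
Proof. by case: z => x y; rewrite /= sqrrN. Qed.

(** The two squares on the left have the same cross term, which cancels. For [x] and [y] of equal
    modulus this is the unimodularity of a Blaschke factor on the circle. *)
Lemma normc_blaschke_sub (a x y : R[i]) :
  normc (y - a^* * x) ^+ 2 - normc (x - a * y) ^+ 2 =
  (1 - normc a ^+ 2) * (normc y ^+ 2 - normc x ^+ 2).
Proof. rewrite !normc_sqr; case: a x y => [a a'] [x x'] [y y'] /=; ring. Qed.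

Definition l2sqnorm a : \bar R := (\sum_(0 <= n <oo) (normc (a n) ^+ 2)%:E)%E.

Definition dirichlet a : \bar R :=
  (\sum_(0 <= n <oo) (n%:R * normc (a n) ^+ 2)%:E)%E.

Lemma l2sqnorm_ge0 a : (0 <= l2sqnorm a)%E.
Proof. by apply: nneseries_ge0 => n _ _; rewrite lee_fin sqr_ge0. Qed.

Lemma dirichlet_ge0 a : (0 <= dirichlet a)%E.
Proof.
by apply: nneseries_ge0 => n _ _; rewrite lee_fin mulr_ge0 ?sqr_ge0.
Qed.

Lemma l2_cvg0 a : (l2sqnorm a < +oo)%E ->
  (a @ \oo --> (0 : (R[i] : numFieldType)))%classic.
Proof.
move=> afin; apply/cvgr0P => e e0.
(* A positive element of [R[i]] is real, so the tolerance can be moved to [R]. *)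
have eE : e = (complex.Re e)%:C%C by rewrite RRe_real// gtr0_real.
move: e0; rewrite eE (_ : (0 < _) = (0 < complex.Re e)) ?ltcR// => e0.
have : cvgn (series (fun n => normc (a n) ^+ 2)).
  by apply: nnseries_is_cvg => // n; exact: sqr_ge0.
move=> /cvg_series_cvg_0/cvgrPdist_lt/(_ _ (exprn_gt0 2 e0)).
apply: filterS => n; rewrite sub0r normrN ger0_norm ?sqr_ge0//.
by rewrite ltr_sqr ?nnegrE ?normc_ge0 ?(ltW e0)// ltcR.
Qed.

(** Coefficients of [H z / (1 - w^* * z)], from solving [h n = k n - w^* * k n.-1] for [k]. *)
Fixpoint div_coef w h n : R[i] :=
  if n is m.+1 then h n + w^* * div_coef w h m else h 0%N.

(** Coefficients of [(z - w) * K z], where [k] expands [K]. *)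
Definition mul_coef w k n : R[i] :=
  if n is m.+1 then k m - w * k n else - w * k 0%N.

Lemma one_sub_conj_neq0 w z : unit_disc w -> unit_disc z -> 1 - w^* * z != 0.
Proof.
rewrite !unit_discE => w1 z1; rewrite subr_eq0; apply/eqP => wz.
have : normc (w^* * z) < 1.
  by rewrite normcM normc_conj mulr_ilt1 ?normc_ge0.
by rewrite -wz normc1 ltxx.
Qed.

Lemma l2sqnorm_div_coef w h :
  unit_disc w -> (l2sqnorm h < +oo)%E -> (l2sqnorm (div_coef w h) < +oo)%E.
Proof.
rewrite unit_discE => w1.
apply: (@l2_filter _ (normc w) (fun n => normc (h n))) => //.
- by rewrite normc_ge0.
- by move=> n; exact: normc_ge0.
- by move=> n; exact: normc_ge0.
- move=> n /=; apply: le_trans (le_normcD _ _) _.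
  by rewrite normcM normc_conj.
Qed.

Lemma power_series_of_div H h w :
  unit_disc w -> (l2sqnorm h < +oo)%E -> power_series_of H h ->
  power_series_of (fun z => H z / (1 - w^* * z)) (div_coef w h).
Proof.
move=> w1 hfin Hh z z1.
apply: (@cvg_series_div R[i] w^* z (H z) h (div_coef w h)) => //.
- exact: one_sub_conj_neq0.
- by apply: cvgr0_mul_expr => //; apply: l2_cvg0; exact: l2sqnorm_div_coef.
- exact: Hh.
Qed.

Lemma power_series_of_mul H k w :
  (l2sqnorm k < +oo)%E -> power_series_of H k ->
  power_series_of (fun z => (z - w) * H z) (mul_coef w k).
Proof.
move=> kfin Hk z z1.
apply: (@cvg_series_mul R[i] w z (H z) (mul_coef w k) k) => //.
- by apply: cvgr0_mul_expr => //; exact: l2_cvg0.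
- exact: Hk.
Qed.

Lemma one_sub_normc_ge0 w : unit_disc w -> 0 <= 1 - normc w ^+ 2.
Proof.
by rewrite unit_discE => w1; rewrite subr_ge0 exprn_ile1 ?normc_ge0// ltW.
Qed.

(** * Blaschke factors and finite Blaschke products *)

Lemma blaschke_factor H h w :
  unit_disc w -> (l2sqnorm h < +oo)%E -> power_series_of H h ->
  let f := mul_coef w (div_coef w h) in
  [/\ power_series_of (fun z => (z - w) / (1 - w^* * z) * H z) f,
      l2sqnorm f = l2sqnorm h &
      dirichlet f = (dirichlet h +
        (1 - normc w ^+ 2)%:E * l2sqnorm (div_coef w h))%E].
Proof.
move=> w1 hfin Hh f; set k := div_coef w h.
have kfin : (l2sqnorm k < +oo)%E by exact: l2sqnorm_div_coef.
have c0 := one_sub_normc_ge0 w1.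
have [||fh dir] := @nneseries_eq_of_telescope R (1 - normc w ^+ 2)
  (fun n => normc (f n) ^+ 2) (fun n => normc (h n) ^+ 2)
  (fun n => normc (k n) ^+ 2) c0 (fun n => sqr_ge0 _) (fun n => sqr_ge0 _)
  (fun n => sqr_ge0 _) kfin.
(* At index 0 the missing coefficient of index -1 counts as 0, so the identity is used with
   [x = 0]. *)
- have := normc_blaschke_sub w 0 (h 0%N).
  by rewrite mulr0 subr0 sub0r normc0 expr0n/= subr0 mulNr.
- by move=> n; rewrite -normc_blaschke_sub /f /= addrK.
split; [|exact: fh|exact: dir].
have := @power_series_of_mul _ k w kfin (power_series_of_div w1 hfin Hh).
apply: eq_power_series_of => z _.
by rewrite mulrCA mulrC.
Qed.

Lemma blaschke_cons w s z :
  blaschke (w :: s) z = (z - w) / (1 - w^* * z) * blaschke s z.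
Proof. by rewrite /blaschke big_cons. Qed.

(** One factor at a time. [H] is arbitrary because the isometry is applied later to
    [G z / (1 - w^* * z)]. *)
Lemma blaschke_isometry H h s :
  {in s, forall w, unit_disc w} -> (l2sqnorm h < +oo)%E ->
  power_series_of H h ->
  exists2 f, power_series_of (fun z => blaschke s z * H z) f &
    l2sqnorm f = l2sqnorm h.
Proof.
move=> + hfin Hh; elim: s => [_|w s IH s1].
  exists h; last by [].
  apply: (eq_power_series_of _ Hh) => z _.
  by rewrite /blaschke big_nil mul1r.
have [|f Hf fh] := IH; first by move=> x xs; apply: s1; rewrite inE xs orbT.
have w1 : unit_disc w by apply: s1; rewrite mem_head.
have ffin : (l2sqnorm f < +oo)%E by rewrite fh.
have [Hf' fh' _] := blaschke_factor w1 ffin Hf.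
exists (mul_coef w (div_coef w f)); last by rewrite fh'.
by apply: eq_power_series_of Hf' => z _; rewrite blaschke_cons mulrA.
Qed.

(* The increments of the Dirichlet integral are the squared norms of
   [blaschke s * G / (1 - w^* z)], where the Blaschke product drops out by
   isometry. *)
Lemma blaschke_dirichlet G g s :
  {in s, forall w, unit_disc w} -> (l2sqnorm g < +oo)%E ->
  power_series_of G g ->
  exists2 f, power_series_of (fun z => blaschke s z * G z) f &
    l2sqnorm f = l2sqnorm g /\
    dirichlet f = (dirichlet g +
      \sum_(w <- s) (1 - normc w ^+ 2)%:E * l2sqnorm (div_coef w g))%E.
Proof.
move=> + gfin Gg; elim: s => [_|w s IH s1].
  exists g; last by rewrite big_nil adde0.
  apply: (eq_power_series_of _ Gg) => z _.
  by rewrite /blaschke big_nil mul1r.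
have s1' : {in s, forall w, unit_disc w}.
  by move=> x xs; apply: s1; rewrite inE xs orbT.
have w1 : unit_disc w by apply: s1; rewrite mem_head.
have [f Hf [fg fdir]] := IH s1'.
have ffin : (l2sqnorm f < +oo)%E by rewrite fg.
have [Hf' fh' fdir'] := blaschke_factor w1 ffin Hf.
exists (mul_coef w (div_coef w f)).
  by apply: eq_power_series_of Hf' => z _; rewrite blaschke_cons mulrA.
split; first by rewrite fh'.
rewrite fdir' fdir big_cons.
have [k Hk kE] := blaschke_isometry s1' (l2sqnorm_div_coef w1 gfin)
  (power_series_of_div w1 gfin Gg).
(* [k] and [div_coef w f] expand the same function, [blaschke s z * G z / (1 - w^* * z)], so they
   coincide. *)
have -> : l2sqnorm (div_coef w g) = l2sqnorm (div_coef w f).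
  rewrite -kE; congr l2sqnorm; apply: power_series_of_inj Hk _.
  apply: (eq_power_series_of _ (power_series_of_div w1 ffin Hf)) => z _.
  by rewrite mulrA.
by rewrite -addeA [X in (_ + X)%E]addeC.
Qed.

End power_series_of.

(** * The norm identity for the weights [C * n] *)

Unset Implicit Arguments.

Theorem corollary3 (R : realType) (gamma : nat -> R) (C : R)
    (F G : R[i] -> R[i]) (m : nat) (alpha : m.-tuple R[i]) :
  nondecreasing_seq gamma ->
  gamma 0%N = 0 ->
  0 < C ->
  (forall n : nat, gamma n.+1 - gamma n = C) ->
  spaceX gamma F ->
  zeros_in_disc F alpha ->
  blaschke_decomposition F alpha G ->
  sqnormX gamma G =
    (sqnormX gamma F -
     \sum_(j < m) ((1 - normc (tnth alpha j) ^+ 2)%:E *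
       sqnormY gamma (fun z => (G z / (1 - (tnth alpha j)^* * z))%R)))%E.
Proof.
move=> _ gamma0 C0 gammaS [_ Ffin] [alpha1 _] [[[g Gg] gfin] _ FE].
have gammaE n : gamma n = C * n%:R.
  elim: n => [|n IH]; first by rewrite gamma0 mulr0.
  by rewrite -[LHS](subrK (gamma n)) gammaS IH -natr1; ring.
have sqnormXE H h : power_series_of H h ->
    sqnormX gamma H = (C%:E * dirichlet h)%E.
  move=> Hh; rewrite /sqnormX (taylorE Hh) -nneseriesZl.
    by apply: eq_eseriesr => n _; rewrite gammaE -EFinM -mulrA.
  by move=> n _; rewrite lee_fin mulr_ge0 ?sqr_ge0.
have sqnormYE H h : power_series_of H h ->
    sqnormY gamma H = (C%:E * l2sqnorm h)%E.
  move=> Hh; rewrite /sqnormY (taylorE Hh) -nneseriesZl.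
    by apply: eq_eseriesr => n _; rewrite gammaS -EFinM.
  by move=> n _; rewrite lee_fin sqr_ge0.
rewrite (taylorE Gg) in gfin.
have [f Ff [_ fE]] := blaschke_dirichlet alpha1 gfin Gg.
have {}Ff : power_series_of F f.
  by apply: (eq_power_series_of _ Ff) => z z1; rewrite FE.
set S := (\sum_(w <- alpha) (1 - normc w ^+ 2)%:E * l2sqnorm (div_coef w g))%E
  in fE.
have S_ge0 w : w \in alpha ->
    (0 <= (1 - normc w ^+ 2)%:E * l2sqnorm (div_coef w g))%E.
  move=> /alpha1 w1.
  by rewrite mule_ge0 ?l2sqnorm_ge0// lee_fin one_sub_normc_ge0.
set Y := (\sum_(j < m) _)%E.
have YE : Y = (C%:E * S)%E.
  rewrite /S big_tuple ge0_sume_distrr => [|j _]; last exact/S_ge0/mem_tnth.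
  apply: eq_bigr => j _.
  have w1 : unit_disc (tnth alpha j) by exact/alpha1/mem_tnth.
  by rewrite (sqnormYE _ _ (power_series_of_div w1 gfin Gg)) muleCA.
have S0 : (0 <= S)%E.
  by rewrite /S big_seq_cond sume_ge0// => w /andP[/S_ge0].
have FGY : sqnormX gamma F = (sqnormX gamma G + Y)%E.
  by rewrite (sqnormXE _ _ Ff) (sqnormXE _ _ Gg) fE YE ge0_muleDr ?dirichlet_ge0.
(* Cancelling [Y] in the extended reals needs it finite: it is nonnegative and at most
   [sqnormX gamma F], since [sqnormX gamma G] is nonnegative. *)
rewrite FGY addeK// ge0_fin_numE; last by rewrite YE mule_ge0// lee_fin ltW.
apply: le_lt_trans Ffin; rewrite FGY leeDr// (sqnormXE _ _ Gg).
by rewrite mule_ge0 ?dirichlet_ge0// lee_fin ltW.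
Qed.
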